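(* Let $K\subset\mathbb{R}^n$ be a finite set of distinct points and let $f_K:K\to\mathbb{R}$ have Lipschitz constant $L>0$ and bound $A_0>0$, that is, $|f_K(x)|\le A_0$ for $x\in K$. Suppose $S\subset K$ generates a Delaunay cell $\mathrm{co}[S]$ with $\dim(\mathrm{co}[S])=n$ and $\dim(\mathrm{co}[\Gamma_s])=n+1$, where $\Gamma_s=\{(x,f_K(x)):\ x\in S\}$ is the graph of $f_K$ restricted to $S$, and suppose $K\setminus S\ne\varnothing$. Let $B(x_s;r_s)$ be the associated open ball of the cell $\mathrm{co}[S]$. Let $p_+,p_-:\mathrm{co}[S]\to\mathbb{R}$ be the piecewise affine concave, respectively convex, functions $$p_+(x)=\max\{v:\ (x,v)\in\mathrm{co}[\Gamma_s]\},\qquad p_-(x)=\min\{v:\ (x,v)\in\mathrm{co}[\Gamma_s]\},$$ and let $\mathrm{co}[S]=\bigcup_{k=1}^{p}D^+_k$ and $\mathrm{co}[S]=\bigcup_{j=1}^{q}D^-_j$ be the associated decompositions (described in the context) into $n$-dimensional convex polytopes on which $p_+$, respectively $p_-$, is affine. Let $C^+_kL$ and $C^-_jL$ be positive upper bounds for $|Dp_+|$ on $D^+_k$ and for $|Dp_-|$ on $D^-_j$, respectively, and let $$C^+_sL=\max_{1\le k\le p}C^+_kL,\qquad C^-_sL=\max_{1\le j\le q}C^-_jL,\qquad C_sL=\max\{C^+_sL,\,C^-_sL\}.$$ Let $\sigma_s=\min\{|x-x_s|-r_s:\ x\in K\setminus S\}>0$. Then for every $x\in\mathrm{co}[S]$,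 $$C^u_\lambda(f^{-M}_K)(x)=\lambda|x-x_s|^2-\lambda r_s^2+p_+(x),\qquad C^l_\lambda(f^{M}_K)(x)=\lambda r_s^2-\lambda|x-x_s|^2+p_-(x),$$ $$A^M_\lambda(f_K)(x)=\frac{p_+(x)+p_-(x)}{2},$$ whenever $$\lambda>\frac{2A_0}{\sigma_s(2r_s+\sigma_s)}+\frac{C_sL}{\sigma_s}\qquad\text{and}\qquad M>\lambda r_s^2+C_sLr_s+A_0+\frac{C_s^2L^2}{4\lambda}.$$
   Context: $\mathrm{co}[E]$ is the convex hull of a set $E$; $\mathrm{co}[g]$ is the convex envelope of a function $g:\mathbb{R}^n\to\mathbb{R}$ bounded below. For bounded $g$ and $\lambda>0$, $$C^l_\lambda(g)(x)=\mathrm{co}[\lambda|\cdot|^2+g](x)-\lambda|x|^2,\qquad C^u_\lambda(g)(x)=\lambda|x|^2-\mathrm{co}[\lambda|\cdot|^2-g](x).$$ For $M>0$, $f_K^{\pm M}$ equals $f_K$ on $K$ and $\pm M$ on $\mathbb{R}^n\setminus K$, and $A^M_\lambda(f_K)=\tfrac12\bigl(C^l_\lambda(f_K^M)+C^u_\lambda(f_K^{-M})\bigr)$. Delaunay cells: a subset $S$ of a finite set $K\subset\mathbb{R}^n$ generates a Delaunay cell $\mathrm{co}[S]$ with associated open ball $B(x_s;r_s)$ ($x_s\in\mathbb{R}^n$, $r_s>0$) if $B(x_s;r_s)\cap K=\varnothing$, $S=K\cap\partial B(x_s;r_s)$ and $\dim(\mathrm{co}[S])=n$. Decompositions: the $D^+_k$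 (respectively $D^-_j$) are finitely many closed convex $n$-dimensional polytopes with pairwise disjoint interiors, whose union is $\mathrm{co}[S]$, whose vertices all belong to $S$, with $p_+$ (respectively $p_-$) equal to an affine function $\ell^+_k$ on $D^+_k$ (respectively $\ell^-_j$ on $D^-_j$), equal to $f_K$ at the vertices of the pieces, and with $\ell^+_k\ge p_+$ (respectively $\ell^-_j\le p_-$) on all of $\mathrm{co}[S]$. They are the projections to $\mathbb{R}^n$ of the upper (respectively lower) $n$-dimensional faces of the polytope $\mathrm{co}[\Gamma_s]\subset\mathbb{R}^n\times\mathbb{R}$. On each piece, $Dp_\pm$ denotes the gradient of the corresponding affine function. *)

(* Defs.v *)
From HB Require Import structures.
From mathcomp Require Import all_boot all_order all_algebra.
From mathcomp Require Import all_classical all_reals all_analysis.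

Set Implicit Arguments.
Unset Strict Implicit.
Unset Printing Implicit Defensive.

Import Order.TTheory GRing.Theory Num.Theory.
Import numFieldNormedType.Exports.

Local Open Scope classical_set_scope.
Local Open Scope ring_scope.

(* The library norm on ['rV[R]_n] is the sup norm, hence the explicit Euclidean
   one below; the two induce the same topology. *)

Definition dot (R : realType) (n : nat) (x y : 'rV[R]_n) : R :=
  \sum_i x 0 i * y 0 i.

Definition enorm (R : realType) (n : nat) (x : 'rV[R]_n) : R :=
  Num.sqrt (dot x x).

Definition eball (R : realType) (n : nat) (c : 'rV[R]_n) (r : R) :
  set 'rV[R]_n := [set x | enorm (x - c) < r].

(* This is the boundary of [eball c r] when [0 < r]. *)
Definition esphere (R : realType) (n : nat) (c : 'rV[R]_n) (r : R) :
  set 'rV[R]_n := [set x | enorm (x - c) = r].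

Definition grad (R : realType) (n : nat) (f : 'rV[R]_n -> R) (x : 'rV[R]_n) :
  'rV[R]_n := \row_i 'D_(delta_mx 0 i) f x.

Definition affine_fun (R : realType) (n : nat) (l : 'rV[R]_n -> R) : Prop :=
  exists a b, forall x, l x = dot a x + b.

Definition co (R : realType) (V : lmodType R) (E : set V) : set V :=
  smallest (@convex_set R V) E.

Definition co_env (R : realType) (n : nat) (g : 'rV[R]_n -> R)
    (x : 'rV[R]_n) : R :=
  sup [set h x | h in [set h : 'rV[R]_n -> R |
                        @convex_function R 'rV[R]_n setT h /\
                        forall y, h y <= g y]].

Definition affinely_independent (R : realType) (V : lmodType R) (m : nat)
    (x : 'I_m -> V) : Prop :=
  forall c : 'I_m -> R,
    \sum_i c i = 0 -> \sum_i c i *: x i = 0 -> forall i, c i = 0.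

(* [dim E = d]: the maximal number of affinely independent points of [E] is
   [d + 1]. *)
Definition has_dim (R : realType) (V : lmodType R) (E : set V) (d : nat) :
    Prop :=
  (exists x : 'I_d.+1 -> V, (forall i, E (x i)) /\ affinely_independent x) /\
  (forall x : 'I_d.+2 -> V, (forall i, E (x i)) -> ~ affinely_independent x).

Definition polytope (R : realType) (V : lmodType R) (P : set V) : Prop :=
  exists F : set V, finite_set F /\ P = co F.

(* For a polytope, these are its vertices. *)
Definition extreme_points (R : realType) (V : lmodType R) (P : set V) :
    set V :=
  [set x | P x /\ forall y z (t : R), P y -> P z -> 0 < t -> t < 1 ->
                    x = t *: y + (1 - t) *: z -> y = x /\ z = x].

Definition lower_transform (R : realType) (n : nat) (lam : R)
    (g : 'rV[R]_n -> R) (x : 'rV[R]_n) : R :=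
  co_env (fun y => lam * enorm y ^+ 2 + g y) x - lam * enorm x ^+ 2.

Definition upper_transform (R : realType) (n : nat) (lam : R)
    (g : 'rV[R]_n -> R) (x : 'rV[R]_n) : R :=
  lam * enorm x ^+ 2 - co_env (fun y => lam * enorm y ^+ 2 - g y) x.

(* A function on [K] is represented by a total function of which only the values
   on [K] are used; this is its extension by the constant [M] outside [K]. *)
Definition ext_const (R : realType) (n : nat) (K : set 'rV[R]_n) (M : R)
    (f : 'rV[R]_n -> R) : 'rV[R]_n -> R :=
  patch (fun=> M) K f.

Definition avg_approx (R : realType) (n : nat) (K : set 'rV[R]_n)
    (f : 'rV[R]_n -> R) (lam M : R) (x : 'rV[R]_n) : R :=
  (lower_transform lam (ext_const K M f) x
   + upper_transform lam (ext_const K (- M) f) x) / 2.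

Definition lipschitz_const (R : realType) (n : nat) (K : set 'rV[R]_n)
    (f : 'rV[R]_n -> R) (L : R) : Prop :=
  forall x y, K x -> K y -> `|f x - f y| <= L * enorm (x - y).

Definition delaunay_cell (R : realType) (n : nat) (K S : set 'rV[R]_n)
    (xs : 'rV[R]_n) (rs : R) : Prop :=
  [/\ 0 < rs,
      eball xs rs `&` K = set0,
      S = K `&` esphere xs rs
    & has_dim (co S) n].

Definition graph_on (R : realType) (n : nat) (S : set 'rV[R]_n)
    (f : 'rV[R]_n -> R) : set ('rV[R]_n * R^o)%type :=
  [set (x, f x : R^o) | x in S].

(* For a finite [S] the fibres below are compact, so that on [co S] the [sup]
   is a maximum and the [inf] a minimum. *)
Definition p_up (R : realType) (n : nat) (S : set 'rV[R]_n)
    (f : 'rV[R]_n -> R) (x : 'rV[R]_n) : R :=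
  sup [set v : R | co (graph_on S f) (x, v : R^o)].

Definition p_low (R : realType) (n : nat) (S : set 'rV[R]_n)
    (f : 'rV[R]_n -> R) (x : 'rV[R]_n) : R :=
  inf [set v : R | co (graph_on S f) (x, v : R^o)].

(* [F] is an [n]-dimensional face of [P] with outward normal [(a, t)]. *)
Definition facet_normal (R : realType) (n : nat)
    (P : set ('rV[R]_n * R^o)%type) (a : 'rV[R]_n) (t : R)
    (F : set ('rV[R]_n * R^o)%type) : Prop :=
  exists b : R,
    [/\ forall z, P z -> dot a z.1 + t * z.2 <= b,
        F = [set z | P z /\ dot a z.1 + t * z.2 = b]
      & has_dim F n].

Definition upper_facet (R : realType) (n : nat)
    (P F : set ('rV[R]_n * R^o)%type) : Prop :=
  exists a t, 0 < t /\ facet_normal P a t F.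

Definition lower_facet (R : realType) (n : nat)
    (P F : set ('rV[R]_n * R^o)%type) : Prop :=
  exists a t, t < 0 /\ facet_normal P a t F.

(* The pieces [D k] and affine functions [l k] of the decomposition of [co S]
   associated with [p] (one of [p_up S f], [p_low S f]); [faces] is the
   corresponding collection of faces of [co (graph_on S f)]. *)
Record decomposition (R : realType) (n : nat) (S : set 'rV[R]_n)
    (f p : 'rV[R]_n -> R) (faces : set (set ('rV[R]_n * R^o)%type))
    (m : nat) (D : 'I_m -> set 'rV[R]_n) (l : 'I_m -> 'rV[R]_n -> R) :
    Prop := {
  dec_polytope : forall k, polytope (D k);
  dec_closed : forall k, closed (D k);
  dec_dim : forall k, has_dim (D k) n;
  dec_disjoint : forall j k, j <> k -> (D j)° `&` (D k)° = set0;
  dec_union : \bigcup_k D k = co S;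
  dec_vertices : forall k, extreme_points (D k) `<=` S;
  dec_affine : forall k, affine_fun (l k);
  dec_eq : forall k x, D k x -> p x = l k x;
  dec_interp : forall k v, extreme_points (D k) v -> p v = f v;
  dec_faces : range D = [set fst @` F | F in faces]
}.

Definition upper_decomposition (R : realType) (n : nat) (S : set 'rV[R]_n)
    (f : 'rV[R]_n -> R) (m : nat) (D : 'I_m -> set 'rV[R]_n)
    (l : 'I_m -> 'rV[R]_n -> R) : Prop :=
  decomposition S f (p_up S f) (upper_facet (co (graph_on S f))) D l /\
  forall k x, co S x -> p_up S f x <= l k x.

Definition lower_decomposition (R : realType) (n : nat) (S : set 'rV[R]_n)
    (f : 'rV[R]_n -> R) (m : nat) (D : 'I_m -> set 'rV[R]_n)
    (l : 'I_m -> 'rV[R]_n -> R) : Prop :=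
  decomposition S f (p_low S f) (lower_facet (co (graph_on S f))) D l /\
  forall k x, co S x -> l k x <= p_low S f x.

Definition gradient_bound (R : realType) (n : nat) (m : nat)
    (D : 'I_m -> set 'rV[R]_n) (l : 'I_m -> 'rV[R]_n -> R) (C : 'I_m -> R)
    (L : R) : Prop :=
  forall k, 0 < C k /\ forall x, D k x -> enorm (grad (l k) x) <= C k * L.

(* The infimum is over a finite nonempty set, hence a minimum. *)
Definition gap (R : realType) (n : nat) (K S : set 'rV[R]_n)
    (xs : 'rV[R]_n) (rs : R) : R :=
  inf [set enorm (x - xs) - rs | x in K `\` S].

(* Main.v *)
Require Import Defs.
From mathcomp Require Import all_boot all_order all_algebra interval_inference.
From mathcomp Require Import all_classical all_reals all_analysis.
From mathcomp Require Import ring lra.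
Import Order.TTheory GRing.Theory Num.Theory.
Import numFieldNormedType.Exports.
Local Open Scope classical_set_scope.
Local Open Scope ring_scope.
Local Open Scope convex_scope.

(** Completing the square gives
      [lam |y|^2 = q y + lam |y - xs|^2 - lam rs^2]
    with [q] affine, so on the sphere through [S] the function whose convex
    envelope defines the lower transform is just [q + f].  Hence a convex
    minorant of [lam |.|^2 + g], where [g] extends [f] by [M], lies below
    [q + f] on [S], and therefore below [q + p_low] on [co S], because [p_low]
    dominates on [co S] every convex function below [f] on [S] ([le_p_low]).
    This bounds the envelope from above.

    For the reverse bound at a point [x] of [co S], take the affine piece [l]
    of [p_low] through [x]; it suffices that the affine function [q + l] is a
    minorant, that is, [lam (rs^2 - d^2) + l y <= g y] with [d = |y - xs|]:
    - on [S], [d = rs] and [l <= p_low <= f];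
    - off [S], comparison with a point [v] of [S] at which [l v = f v]
      ([p_low_touches]) gives [l y <= A0 + C (d + rs)] for a bound [C] of the
      gradient of [l]; on [K] the distance [d] exceeds [rs] by at least the gap,
      and the lower bound on [lam] makes the quadratic term win
      ([quadratic_beats_gap]);
    - off [K], the same bound on [l y] is used: the term [C d] is absorbed by
      [lam d^2] at the price [C^2 / (4 lam)] ([quadratic_absorbs_linear]), and
      [M] is large enough.

    The upper transform needs no separate argument: up to sign, replacing [f]
    by [- f] exchanges the two transforms as well as [p_up] and [p_low]
    ([upper_transform_ext], [p_up_low]).  In the average the quadratic terms
    cancel. *)

(** * Euclidean inner product and norm *)

Section EuclideanSpace.
Context {R : realType} {n : nat}.
Implicit Types (a x y z : 'rV[R]_n) (s t : R).

Lemma dotC x y : dot x y = dot y x.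
Proof. by apply: eq_bigr => i _; rewrite mulrC. Qed.

Lemma dotDl x y z : dot (x + y) z = dot x z + dot y z.
Proof. by rewrite -big_split; apply: eq_bigr => i _; rewrite mxE mulrDl. Qed.

Lemma dotZl t x y : dot (t *: x) y = t * dot x y.
Proof. by rewrite mulr_sumr; apply: eq_bigr => i _; rewrite mxE mulrA. Qed.

Lemma dotNl x y : dot (- x) y = - dot x y.
Proof. by rewrite -scaleN1r dotZl mulN1r. Qed.

Lemma dotDr x y z : dot x (y + z) = dot x y + dot x z.
Proof. by rewrite !(dotC x) dotDl. Qed.

Lemma dotZr t x y : dot x (t *: y) = t * dot x y.
Proof. by rewrite !(dotC x) dotZl. Qed.

Lemma dotNr x y : dot x (- y) = - dot x y.
Proof. by rewrite !(dotC x) dotNl. Qed.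

Lemma dot_ge0 x : 0 <= dot x x.
Proof. by apply: sumr_ge0 => i _; rewrite -expr2 sqr_ge0. Qed.

Lemma enorm_ge0 x : 0 <= enorm x.
Proof. exact: sqrtr_ge0. Qed.

Lemma enorm_sqr x : enorm x ^+ 2 = dot x x.
Proof. by rewrite sqr_sqrtr// dot_ge0. Qed.

Lemma enormN x : enorm (- x) = enorm x.
Proof. by rewrite /enorm dotNl dotNr opprK. Qed.

Lemma dot_eq0 x : dot x x = 0 -> x = 0.
Proof.
move/eqP; rewrite psumr_eq0 => [|i _]; last by rewrite -expr2 sqr_ge0.
move/allP => x0; apply/rowP => i; rewrite mxE.
by have := x0 i (mem_index_enum i); rewrite mulf_eq0 orbb => /eqP.
Qed.

(** Cauchy-Schwarz, from the nonnegativity of the square of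
    [(y.y) x - (x.y) y]; multiplying by [y.y] avoids any division. *)
Lemma dot_le_enorm x y : dot x y <= enorm x * enorm y.
Proof.
have [y0|y0] := eqVneq (dot y y) 0.
  by rewrite (dot_eq0 _ y0) -(scale0r y) dotZr mul0r mulr_ge0// enorm_ge0.
have yy : 0 < dot y y by rewrite lt_neqAle eq_sym y0 dot_ge0.
rewrite -[leRHS]ger0_norm ?mulr_ge0 ?enorm_ge0//.
apply: le_trans (ler_norm _) _; rewrite -ler_sqr ?nnegrE ?normr_ge0//.
rewrite !real_normK ?num_real// exprMn !enorm_sqr -(ler_pM2r yy) -subr_ge0.
have := dot_ge0 (dot y y *: x - dot x y *: y).
rewrite !(dotDl, dotDr, dotNl, dotNr, dotZl, dotZr) (dotC y x).
lra.
Qed.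

Lemma enormD x y : enorm (x + y) <= enorm x + enorm y.
Proof.
rewrite -ler_sqr ?nnegrE ?addr_ge0 ?enorm_ge0// sqrrD !enorm_sqr.
rewrite !(dotDl, dotDr) (dotC y x); have := dot_le_enorm x y; lra.
Qed.

Lemma enorm_sqrB x y :
  enorm (x - y) ^+ 2 = enorm x ^+ 2 - 2 * dot y x + enorm y ^+ 2.
Proof. rewrite !enorm_sqr !(dotDl, dotDr, dotNl, dotNr) (dotC x y); ring. Qed.

(** The difference quotients are constant, equal to [a 0 i]. *)
Lemma grad_affine a (b : R) x : grad (fun y => dot a y + b) x = a.
Proof.
apply/rowP => i; rewrite mxE; apply: cvg_lim => //=.
apply/cvgrPdist_le => e e0; near=> h.
have h0 : h != 0 by near: h; exact: nbhs_dnbhs_neq.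
rewrite dotDr dotZr opprD addrACA subrr addr0 addrK /GRing.scale/= mulKf//.
rewrite /dot (bigD1 i)//= big1 => [|j ji]; last by rewrite mxE (negbTE ji) andbF mulr0.
by rewrite mxE !eqxx mulr1 addr0 subrr normr0 ltW.
Unshelve. all: by end_near. Qed.

End EuclideanSpace.

(** * Convex functions and the lower boundary of the hull of a graph *)

(** Strict inequalities over a finite set hold with a uniform margin; this
    serves both the gap around the empty ball and [p_low_touches]. *)
Lemma finite_pos_lbound {R : realType} {T : eqType} (A : set T) (phi : T -> R) :
  finite_set A -> (forall x, A x -> 0 < phi x) ->
  exists2 e, 0 < e & forall x, A x -> e <= phi x.
Proof.
move=> /finite_seqP[s ->]; elim: s => [|y s IH] phi0; first by exists 1.
have [|e e0 es] := IH; first by move=> x xs; apply: phi0; rewrite /= inE xs orbT.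
exists (Num.min e (phi y)); first by rewrite lt_min e0 phi0//= mem_head.
by move=> x /=; rewrite inE ge_min => /orP[/eqP->|/es->//]; rewrite lexx orbT.
Qed.

Section Convexity.
Context {R : realType} {n : nat}.
Implicit Types (h k l f : 'rV[R]_n -> R) (S : set 'rV[R]_n).

Lemma lmod_convE (V : lmodType R) (t : {i01 R}) (x y : V) :
  (x : convex_lmodType V) <| t |> y = t%:num *: x + (1 - t%:num) *: y.
Proof. by []. Qed.

Lemma real_convE (t : {i01 R}) (u v : R^o) :
  u <| t |> v = t%:num * u + (1 - t%:num) * v.
Proof. by []. Qed.

Lemma affine_convex l : affine_fun l -> convex_function setT l.
Proof.
move=> [a [b lE]] t x y _ _; rewrite !lE real_convE.
rewrite lmod_convE dotDr !dotZr.
lra.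
Qed.

Lemma convex_functionD h k : convex_function setT h -> convex_function setT k ->
  convex_function setT (fun x => h x + k x).
Proof.
move=> ch ck t x y xT yT; apply: le_trans (lerD (ch t x y xT yT) (ck t x y xT yT)) _.
rewrite !real_convE; lra.
Qed.

(** The epigraph of [h] is a convex set containing the graph of [f] over [S]. *)
Lemma convex_le_co_graph S f h : convex_function setT h ->
  (forall y, S y -> h y <= f y) ->
  forall x v, co (graph_on S f) (x, v) -> h x <= v.
Proof.
move=> ch hf x v xv.
suff : [set z : 'rV[R]_n * R^o | h z.1 <= z.2] (x, v) by [].
apply: xv; split; last by move=> _ [y Sy <-] /=; exact: hf.
move=> [y u] [z w] t; rewrite !inE/= => hy hz.
apply: le_trans (ch t y z _ _) _; rewrite ?inE// !real_convE.
by apply: lerD; rewrite ler_wpM2l// subr_ge0.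
Qed.

Lemma co_convex {V : lmodType R} (E : set V) : convex_set (co E).
Proof.
move=> x y t; rewrite !inE => Ex Ey A [cA EA]; have := cA x y t.
by rewrite !inE; apply; [exact: Ex|exact: Ey].
Qed.

(** The projection of the hull of the graph is convex and contains [S]; without
    this, [p_low] could be the infimum of an empty set. *)
Lemma co_fibre_neq0 S f x : co S x -> exists v, co (graph_on S f) (x, v).
Proof.
apply: (@smallest_sub _ _ S [set x | exists v, co (graph_on S f) (x, v)]).
  move=> y z t; rewrite !inE/= => -[v yv] [w zw].
  exists (t%:num * v + (1 - t%:num) * w).
  have := @co_convex _ (graph_on S f) (y, v) (z, w) t.
  by rewrite !inE; apply.
by move=> y Sy; exists (f y); apply: sub_gen_smallest; exists y.
Qed.

(** [p_low] is the largest convex minorant on [co S] of the data on [S]; this is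
    the half of that fact which bounds convex envelopes from above. *)
Lemma le_p_low S f h x : convex_function setT h ->
  (forall y, S y -> h y <= f y) -> co S x -> h x <= p_low S f x.
Proof.
move=> ch hf /(@co_fibre_neq0 _ f)[w xw].
by apply: lb_le_inf => [|v]; [exists w|exact: convex_le_co_graph].
Qed.

(** A lower bound [m] for the data is required since the infimum of a set
    unbounded below has a junk value. *)
Lemma p_low_le (m : R) S f x : (forall y, S y -> m <= f y) ->
  S x -> p_low S f x <= f x.
Proof.
move=> mf Sx; apply: ge_inf; last by apply: sub_gen_smallest; exists x.
exists m => v; apply: (@convex_le_co_graph _ _ (fun=> m)) => //.
by apply: affine_convex; exists 0, m => y; rewrite -(scale0r 0) dotZl mul0r add0r.
Qed.

(** An affine function that meets [p_low] somewhere cannot be strictly below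
    the data at every point of [S]: by finiteness it could be raised by some
    [e > 0] and would still be a convex minorant, hence below [p_low]. *)
Lemma p_low_touches S f l x : finite_set S -> affine_fun l -> co S x ->
  p_low S f x = l x -> exists2 v, S v & f v <= l v.
Proof.
move=> finS [a [b lE]] Sx pl; apply: contrapT => noV.
have [|e e0 el] := @finite_pos_lbound _ _ _ (fun y => f y - l y) finS.
  move=> y Sy; rewrite subr_gt0 ltNge; apply/negP => fl; apply: noV.
  by exists y.
have : l x + e <= p_low S f x.
  apply: (@le_p_low S f (fun y => l y + e)) => //.
    by apply: affine_convex; exists a, (b + e) => y; rewrite lE addrA.
  by move=> y /el; lra.
by rewrite pl; lra.
Qed.

Lemma co_env_eq (g h : 'rV[R]_n -> R) x : convex_function setT h ->
  (forall y, h y <= g y) ->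
  (forall k, convex_function setT k -> (forall y, k y <= g y) -> k x <= h x) ->
  co_env g x = h x.
Proof.
move=> ch hg hmax; have ub : ubound
    [set k x | k in [set k | convex_function setT k /\ forall y, k y <= g y]] (h x).
  by move=> _ [k [ck kg] <-]; exact: hmax.
apply/eqP; rewrite eq_le; apply/andP; split.
  by apply: ge_sup => //; exists (h x), h.
by apply: ub_le_sup; [exists (h x)|exists h].
Qed.

Lemma co_graphN S f x (v : R) :
  co (graph_on S f) (x, v) -> co (graph_on S (\- f)) (x, - v).
Proof.
apply: (@smallest_sub _ _ (graph_on S f)
  [set z | co (graph_on S (\- f)) (z.1, - z.2)] _ _ (x, v)).
  move=> [y u] [z w] t; rewrite !inE/= => yu zw.
  have := @co_convex _ (graph_on S (\- f)) (y, - u) (z, - w) t; rewrite !inE => /(_ yu zw).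
  by congr (co _ (_, _)); exact: esym (convN u w t).
by move=> _ [y Sy <-]; apply: sub_gen_smallest; exists y.
Qed.

(** The reflection [(x, v) |-> (x, - v)] maps the hull of the graph of [f] onto
    that of [- f]. *)
Lemma p_up_low S f x : p_up S f x = - p_low S (\- f) x.
Proof.
rewrite /p_low /inf opprK; congr sup; apply/seteqP; split => v /=.
  by move=> /co_graphN xv; exists (- v); rewrite ?opprK.
move=> [w /co_graphN xw <-]; move: xw.
by congr (co (graph_on _ _) _); apply/funext => y; rewrite /= opprK.
Qed.

End Convexity.

(** * Two scalar estimates behind the thresholds for [lam] and [M] *)

Section Estimates.
Context {R : realType}.
Implicit Types (r d sigma lam A C : R).

(** The difference of the two sides is [(2 lam d - C)^2 / (4 lam)]. *)
Lemma quadratic_absorbs_linear d lam C : 0 < lam ->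
  C * d <= lam * d ^+ 2 + C ^+ 2 / (4 * lam).
Proof.
move=> lam0; have l0 : lam != 0 by rewrite gt_eqF.
rewrite -subr_ge0 (_ : _ - _ = (2 * lam * d - C) ^+ 2 / (4 * lam)); last by field.
by rewrite divr_ge0 ?sqr_ge0// mulr_ge0// ltW.
Qed.

(** Factor [d^2 - r^2 = (d - r) (d + r)], with [d - r >= sigma] and
    [d + r >= 2 r + sigma]: the first summand of the threshold for [lam] pays
    for [2 A], the second for [C (d + r)]. *)
Lemma quadratic_beats_gap r d sigma lam A C :
  0 <= r -> 0 < sigma -> 0 <= A -> 0 <= C ->
  2 * A / (sigma * (2 * r + sigma)) + C / sigma < lam -> r + sigma <= d ->
  2 * A + C * (d + r) <= lam * (d ^+ 2 - r ^+ 2).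
Proof.
move=> r0 s0 A0 C0 + rsd; set P := _ / (_ * _); set Q := _ / _ => PQ.
have AE : 2 * A = P * (sigma * (2 * r + sigma)).
  by rewrite /P divfK// mulf_neq0// gt_eqF// ltr_wpDl// mulr_ge0.
have CE : C = Q * sigma by rewrite /Q divfK// gt_eqF.
have P0 : 0 <= P by rewrite /P divr_ge0// mulr_ge0// ?addr_ge0 ?mulr_ge0// ltW.
have Q0 : 0 <= Q by rewrite divr_ge0// ltW.
have d0 : 0 <= d + r by lra.
have dr : sigma * (d + r) <= d ^+ 2 - r ^+ 2.
  by rewrite subr_sqr ler_wpM2r// lerBrDl.
have rd : sigma * (2 * r + sigma) <= sigma * (d + r).
  by rewrite ler_pM2l//; lra.
clearbody P Q; rewrite AE CE -mulrA; apply: (@le_trans _ _ ((P + Q) * (d ^+ 2 - r ^+ 2))).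
  rewrite [leRHS]mulrDl; apply: lerD; apply: ler_wpM2l => //.
  exact: le_trans rd dr.
apply: ler_wpM2r; last exact: ltW.
by apply: (le_trans _ dr); rewrite mulr_ge0// ltW.
Qed.

End Estimates.

(** * The transforms on a Delaunay cell *)

Section LowerTransform.
Context {R : realType} {n : nat}.
Implicit Types (K S : set 'rV[R]_n) (f : 'rV[R]_n -> R).

(** Only an affine minorant of [p_low] touching it at [x] matters, so the
    statement speaks of one such function instead of a decomposition.  It is
    applied to [- f] as well, with the negated pieces of [p_up], to obtain the
    upper transform. *)
Lemma lower_transform_cell K S f (A0 rs sigma b C lam M : R) (xs a x : 'rV[R]_n) :
  finite_set S -> S `<=` K -> (forall y, K y -> `|f y| <= A0) ->
  (forall y, S y -> enorm (y - xs) = rs) ->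
  (forall y, K y -> ~ S y -> rs + sigma <= enorm (y - xs)) ->
  0 <= rs -> 0 < sigma -> 0 <= A0 -> enorm a <= C ->
  (forall y, co S y -> dot a y + b <= p_low S f y) ->
  co S x -> p_low S f x = dot a x + b ->
  2 * A0 / (sigma * (2 * rs + sigma)) + C / sigma < lam ->
  lam * rs ^+ 2 + C * rs + A0 + C ^+ 2 / (4 * lam) < M ->
  lower_transform lam (ext_const K M f) x
    = lam * rs ^+ 2 - lam * enorm (x - xs) ^+ 2 + p_low S f x.
Proof.
move=> finS SK fA0 Srs Kgap rs0 s0 A00 aC l_low Sx lx lam_gt M_gt.
have C0 : 0 <= C := le_trans (enorm_ge0 a) aC.
have lam0 : 0 < lam.
  apply: le_lt_trans lam_gt; apply: addr_ge0; apply: divr_ge0 => //; last exact: ltW.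
    by rewrite mulr_ge0.
  by rewrite mulr_ge0 ?addr_ge0 ?mulr_ge0// ltW.
have fS y : S y -> - A0 <= f y by move=> /SK /fA0; rewrite ler_norml => /andP[].
(* [v] is the point of comparison for [l] away from [S]. *)
have [v Sv fv] : exists2 v, S v & f v <= dot a v + b.
  by apply: p_low_touches Sx lx => //; exists a, b.
have {}fv : dot a v + b = f v.
  apply/eqP; rewrite eq_le fv andbT; apply: (le_trans _ (p_low_le _ _ _ _ fS Sv)).
  by apply: l_low; apply: sub_gen_smallest.
have la y : dot a y + b <= A0 + C * (enorm (y - xs) + rs).
  have -> : dot a y + b = f v + dot a (y - v) by rewrite dotDr dotNr -fv; ring.
  apply: lerD; first by have := fA0 _ (SK _ Sv); rewrite ler_norml => /andP[].
  apply: le_trans (dot_le_enorm _ _) _.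
  apply: ler_pM => //; try exact: enorm_ge0.
  rewrite -(Srs v Sv) -(enormN (v - xs)); apply: (le_trans _ (enormD _ _)).
  by rewrite opprB addrA subrK.
(* [q] is the affine part of [lam |y|^2] relative to the sphere, see [qE]. *)
pose q y := 2 * lam * dot xs y - lam * enorm xs ^+ 2 + lam * rs ^+ 2.
have qE y : q y = lam * enorm y ^+ 2 + lam * rs ^+ 2 - lam * enorm (y - xs) ^+ 2.
  by rewrite enorm_sqrB /q; ring.
have caff (a' : 'rV[R]_n) (b' : R) : convex_function setT (fun y => dot a' y + b').
  by apply: affine_convex; exists a', b'.
rewrite /lower_transform (@co_env_eq _ _ _ (fun y => q y + (dot a y + b))).
(* Value of the minorant [q + l] at [x]. *)
- by rewrite qE lx; ring.
- apply: convex_functionD => //.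
  have -> : q = (fun y => dot (2 * lam *: xs) y + (lam * rs ^+ 2 - lam * enorm xs ^+ 2)).
    by apply/funext => y; rewrite dotZl /q; ring.
  exact: caff.
(* [q + l] is a minorant: points of [S], of [K] outside [S], and outside [K]. *)
- move=> y; rewrite qE /ext_const /patch; case: ifPn; rewrite ?inE ?notin_setE => Ky.
    have [Sy|NSy] := pselect (S y).
      have Cy : co S y by apply: sub_gen_smallest.
      have := l_low y Cy; have := p_low_le _ _ _ _ fS Sy.
      by rewrite (Srs y Sy); lra.
    have := quadratic_beats_gap _ _ _ _ _ _ rs0 s0 A00 C0 lam_gt (Kgap y Ky NSy).
    by have := la y; have := fA0 y Ky; rewrite ler_norml => /andP[]; lra.
  by have := quadratic_absorbs_linear (enorm (y - xs)) _ C lam0; have := la y; lra.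
(* No convex minorant exceeds [q + p_low] at [x]. *)
- move=> k ck kg; rewrite -lx.
  suff : k x + - q x <= p_low S f x by lra.
  apply: (@le_p_low _ _ _ _ (fun y => k y + - q y)) => //.
    apply: convex_functionD => //.
    have -> : (fun y => - q y) = (fun y => dot (- (2 * lam) *: xs) y
        + (lam * enorm xs ^+ 2 - lam * rs ^+ 2)).
      by apply/funext => y; rewrite dotZl /q; ring.
    exact: caff.
  move=> y Sy; have := kg y; rewrite /ext_const /patch mem_set; last exact: SK.
  by rewrite qE (Srs y Sy); lra.
Qed.

Lemma upper_transform_ext K f (lam M : R) (x : 'rV[R]_n) :
  upper_transform lam (ext_const K (- M) f) x
    = - lower_transform lam (ext_const K M (\- f)) x.
Proof.
rewrite /upper_transform /lower_transform opprB; congr (_ - co_env _ x).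
apply/funext => y; congr (_ + _); rewrite /ext_const /patch.
by case: ifP; rewrite ?opprK.
Qed.

End LowerTransform.

Theorem theorem4p11 (R : realType) (n : nat)
    (K S : set 'rV[R]_n) (f : 'rV[R]_n -> R) (L A0 : R)
    (xs : 'rV[R]_n) (rs : R)
    (mp : nat) (Dp : 'I_mp -> set 'rV[R]_n) (lp : 'I_mp -> 'rV[R]_n -> R)
    (Cp : 'I_mp -> R)
    (mm : nat) (Dm : 'I_mm -> set 'rV[R]_n) (lm : 'I_mm -> 'rV[R]_n -> R)
    (Cm : 'I_mm -> R)
    (finK : finite_set K)
    (L_gt0 : 0 < L) (f_lip : lipschitz_const K f L)
    (A0_gt0 : 0 < A0) (f_bound : forall x, K x -> `|f x| <= A0)
    (cell : delaunay_cell K S xs rs)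
    (dim_graph : has_dim (co (graph_on S f)) n.+1)
    (KS_neq0 : K `\` S !=set0)
    (dec_up : upper_decomposition S f Dp lp)
    (dec_low : lower_decomposition S f Dm lm)
    (bound_up : gradient_bound Dp lp Cp L)
    (bound_low : gradient_bound Dm lm Cm L) :
  let CspL := \big[Num.max/0]_(k < mp) (Cp k * L) in
  let CsmL := \big[Num.max/0]_(j < mm) (Cm j * L) in
  let CsL := Num.max CspL CsmL in
  let sigma := gap K S xs rs in
  0 < sigma /\
  forall lam M : R,
    2 * A0 / (sigma * (2 * rs + sigma)) + CsL / sigma < lam ->
    lam * rs ^+ 2 + CsL * rs + A0 + CsL ^+ 2 / (4 * lam) < M ->
    forall x, co S x ->
    [/\ upper_transform lam (ext_const K (- M) f) x
          = lam * enorm (x - xs) ^+ 2 - lam * rs ^+ 2 + p_up S f x,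
        lower_transform lam (ext_const K M f) x
          = lam * rs ^+ 2 - lam * enorm (x - xs) ^+ 2 + p_low S f x
      & avg_approx K f lam M x = (p_up S f x + p_low S f x) / 2].
Proof.
move=> CspL CsmL CsL sigma.
have [rs0 ballK SE _] := cell.
have SK : S `<=` K by rewrite SE => y [].
have Srs y : S y -> enorm (y - xs) = rs by rewrite SE => -[].
have finS : finite_set S := sub_finite_set SK finK.
have out y : (K `\` S) y -> 0 < enorm (y - xs) - rs.
  move=> [Ky NSy]; rewrite subr_gt0 lt_neqAle leNgt; apply/andP; split.
    by apply/eqP => rE; apply: NSy; rewrite SE; split.
  by apply/negP => yB; have : (eball xs rs `&` K) y by []; rewrite ballK.
have [e e0 eK] := @finite_pos_lbound _ _ _ _ (finite_setD _ finK) out.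
have e_lb : lbound [set enorm (x - xs) - rs | x in K `\` S] e.
  by move=> _ [y Ky <-]; exact: eK.
have s0 : 0 < sigma.
  apply: lt_le_trans e0 _; apply: lb_le_inf => //.
  by have [y Ky] := KS_neq0; exists (enorm (y - xs) - rs), y.
split=> // lam M lam_gt M_gt x Sx.
have Kgap y : K y -> ~ S y -> rs + sigma <= enorm (y - xs).
  move=> Ky NSy; suff : sigma <= enorm (y - xs) - rs by lra.
  by apply: ge_inf; [exists e|exists y].
have low : lower_transform lam (ext_const K M f) x
    = lam * rs ^+ 2 - lam * enorm (x - xs) ^+ 2 + p_low S f x.
  have [dec lmp] := dec_low.
  have [j _ Dx] : (\bigcup_j Dm j) x by rewrite (dec_union dec).
  have [a [b lE]] := dec_affine dec j.
  have [_ /(_ x Dx)] := bound_low j.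
  rewrite (_ : lm j = (fun y => dot a y + b)); last exact/funext.
  rewrite grad_affine => aC.
  apply: (@lower_transform_cell _ _ K S f A0 rs sigma b CsL lam M xs a x) => //.
  - exact: ltW.
  - exact: ltW.
  - apply: (le_trans aC); rewrite le_max; apply/orP; right.
    exact: (le_bigmax _ (fun k => Cm k * L) j).
  - by move=> y /(lmp j); rewrite lE.
  - by rewrite (dec_eq dec Dx) lE.
have up : upper_transform lam (ext_const K (- M) f) x
    = lam * enorm (x - xs) ^+ 2 - lam * rs ^+ 2 + p_up S f x.
  have [dec lpp] := dec_up.
  have [j _ Dx] : (\bigcup_j Dp j) x by rewrite (dec_union dec).
  have [a [b lE]] := dec_affine dec j.
  have [_ /(_ x Dx)] := bound_up j.
  rewrite (_ : lp j = (fun y => dot a y + b)); last exact/funext.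
  rewrite grad_affine => aC.
  rewrite upper_transform_ext p_up_low.
  rewrite (@lower_transform_cell _ _ K S (\- f) A0 rs sigma (- b) CsL lam M xs (- a) x) => //.
  - by ring.
  - by move=> y Ky; rewrite normrN; exact: f_bound.
  - exact: ltW.
  - exact: ltW.
  - rewrite enormN; apply: (le_trans aC); rewrite le_max; apply/orP; left.
    exact: (le_bigmax _ (fun k => Cp k * L) j).
  - by move=> y /(lpp j); rewrite lE p_up_low dotNl; lra.
  - by have := dec_eq dec Dx; rewrite lE p_up_low dotNl; lra.
by split=> //; rewrite /avg_approx low up; congr (_ / _); ring.
Qed.
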